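(* Consider an instance of the disjoint-cardinality constrained assortment problem under the two-level nested logit model with $m$ nests and $n$ products per nest. Let $\mathcal{T}_1,\ldots,\mathcal{T}_m$ be the nest candidate sets and let $S(z)=(S_1(z),\ldots,S_m(z))$, $z\in\mathbb{R}$, be the assortments defined in the context. Then the set of assortments $\mathcal{T}=\{S(z): -\infty<z<\infty\}$ contains at least one optimal assortment, and $|\mathcal{T}|=O(mn^2)$, i.e. there is an absolute constant $K$ (independent of the instance) with $|\mathcal{T}|\le K m n^2$.
   Context: Setting. There are $m\ge 1$ nests, each with $n\ge1$ products. Product $j$ of nest $i$ has weight $v_{ij}\ge 0$ and revenue $r_{ij}\ge 0$; the no-purchase option has weight $v_0>0$. Nest $i$ has a dissimilarity parameter $\gamma_i\in(0,1]$ and a capacity $C_i$ (a nonnegative integer). An assortment is $S=(S_1,\ldots,S_m)$ with $S_i\subseteq\{1,\ldots,n\}$ the set of products offered in nest $i$; it is feasible if $|S_i|\le C_i$ for all $i$. Put $V_i(S_i)=\sum_{j\in S_i}v_{ij}$ and $R_i(S_i)=\frac{\sum_{j\in S_i}r_{ij}v_{ij}}{V_i(S_i)}$, with the convention $R_i(S_i)=0$ if $V_i(S_i)=0$ (so that $V_i(S_i)^{\gamma_i}(R_i(S_i)-z)=0$ in that case). The expected revenue of $S$ is $$\Pi(S)=\frac{\sum_{i=1}^m V_i(S_i)^{\gamma_i}R_i(S_i)}{v_0+\sum_{i=1}^m V_i(S_i)^{\gamma_i}}.$$ An optimal assortment is a feasible assortment maximizing $\Pi$ over all feasible assortments. Nest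 candidate sets. For nest $i$ and $u\in\mathbb{R}$, let $\hat S_i(u)$ be one optimal solution of $\max_{S_i:|S_i|\le C_i}V_i(S_i)(R_i(S_i)-u)=\max_{S_i:|S_i|\le C_i}\sum_{j\in S_i}v_{ij}(r_{ij}-u)$, obtained by taking the (at most) $C_i$ products with the largest values of $f_j(u)=v_{ij}(r_{ij}-u)$ among those with $f_j(u)\ge 0$. Ties are resolved so that $\hat S_i(\cdot)$ is constant on each open interval between consecutive crosspoints (the $u$-values at which two distinct lines among $f_0\equiv 0,f_1,\ldots,f_n$ intersect), and at a crosspoint $\hat S_i$ takes either its value immediately to the left or its value immediately to the right. Set $\mathcal{T}_i=\{\hat S_i(u):u\in\mathbb{R}\}$. The assortments $S(z)$. For $z\in\mathbb{R}$ let $S_i(z)$ be an element of $\arg\max_{S_i\in\mathcal{T}_i}V_i(S_i)^{\gamma_i}(R_i(S_i)-z)$, chosen so that $S_i(\cdot)$ is constant on each open interval between consecutive breakpoints of the piecewise-linear function $g_i(z)=\max_{S_i\in\mathcal{T}_i}V_i(S_i)^{\gamma_i}(R_i(S_i)-z)$, and so that at a breakpoint $S_i(z)$ equals, arbitrarily, either its value immediately to the left or its value immediately to the right. Set $S(z)=(S_1(z),\ldots,S_m(z))$. *)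

(* Defs.v *)
From mathcomp Require Import all_boot all_order all_algebra.
From mathcomp Require Import all_classical all_reals all_analysis.

Set Implicit Arguments.
Unset Strict Implicit.
Unset Printing Implicit Defensive.

Import Order.TTheory GRing.Theory Num.Theory.
Import numFieldNormedType.Exports.

Local Open Scope classical_set_scope.
Local Open Scope ring_scope.

Record nl_instance (R : realType) (m n : nat) := NLInstance {
  weight : 'I_m -> 'I_n -> R;
  revenue : 'I_m -> 'I_n -> R;
  nopurchase : R;
  dissim : 'I_m -> R;
  capacity : 'I_m -> nat;
  weight_ge0 : forall i j, 0 <= weight i j;
  revenue_ge0 : forall i j, 0 <= revenue i j;
  nopurchase_gt0 : 0 < nopurchase;
  dissim_gt0 : forall i, 0 < dissim i;
  dissim_le1 : forall i, dissim i <= 1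
}.

Definition assortment (m n : nat) : Type := {ffun 'I_m -> {set 'I_n}}.

Section NestedLogit.
Context {R : realType} {m n : nat}.
Variable I : nl_instance R m n.
Implicit Types (i : 'I_m) (A B : {set 'I_n}) (S : assortment m n) (u z : R).

Definition nestV i A : R := \sum_(j in A) weight I i j.

(* Division by 0 yields 0, which is the convention R_i(A) = 0 if V_i(A) = 0. *)
Definition nestR i A : R :=
  (\sum_(j in A) revenue I i j * weight I i j) / nestV i A.

Definition expected_revenue S : R :=
  (\sum_i nestV i (S i) `^ dissim I i * nestR i (S i)) /
  (nopurchase I + \sum_i nestV i (S i) `^ dissim I i).

Definition feasible S : Prop := forall i, (#|S i| <= capacity I i)%N.

Definition optimal S : Prop :=
  feasible S /\
  forall S', feasible S' -> expected_revenue S' <= expected_revenue S.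

(* [None] is the line f_0 = 0 and [Some j] is the line of product j. *)
Definition line i (a : option 'I_n) u : R :=
  if a is Some j then weight I i j * (revenue I i j - u) else 0.

Definition crosspoint i : set R :=
  [set u | exists a b, line i a <> line i b /\ line i a u = line i b u].

Definition linear_optimal i u A : Prop :=
  (#|A| <= capacity I i)%N /\
  forall B, (#|B| <= capacity I i)%N ->
    nestV i B * (nestR i B - u) <= nestV i A * (nestR i A - u).

(* A consists of products with the largest nonnegative values of f_j(u), at
   most C_i of them.  Products with f_j(u) = 0 may be left out: at a crosspoint
   with f_0 the value of the selection inherited from the right does so. *)
Definition top_products i u A : Prop :=
  [/\ (#|A| <= capacity I i)%N,
      forall j, j \in A -> 0 <= line i (Some j) u,
      forall j k, j \in A -> k \notin A ->
        line i (Some k) u <= line i (Some j) u &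
      (#|A| < capacity I i)%N ->
        forall k, k \notin A -> line i (Some k) u <= 0].

(* [s] is constant on every interval free of points of [D], including the
   unbounded ones, and at a point of [D] it takes its value immediately to the
   left or its value immediately to the right. *)
Definition constant_between (T : Type) (D : set R) (s : R -> T) : Prop :=
  (forall x y, x <= y -> (forall t, x <= t <= y -> ~ D t) -> s x = s y) /\
  (forall d, D d ->
    (\forall y \near d^'-, s y = s d) \/ (\forall y \near d^'+, s y = s d)).

Definition candidate_selection i (hatS : R -> {set 'I_n}) : Prop :=
  (forall u, linear_optimal i u (hatS u) /\ top_products i u (hatS u)) /\
  constant_between (crosspoint i) hatS.

Definition nest_objective i z A : R :=
  nestV i A `^ dissim I i * (nestR i A - z).

(* The supremum is a maximum when [T] is nonempty, since {set 'I_n} is finite. *)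
Definition nest_max i (T : set {set 'I_n}) z : R :=
  sup [set nest_objective i z A | A in T].

(* For a piecewise-linear g: the points near which g is not affine. *)
Definition breakpoint (g : R -> R) : set R :=
  [set z | ~ exists a b : R, \forall y \near z, g y = a * y + b].

Definition revenue_selection i (T : set {set 'I_n}) (s : R -> {set 'I_n}) :
    Prop :=
  (forall z, T (s z) /\
    forall A, T A -> nest_objective i z A <= nest_objective i z (s z)) /\
  constant_between (breakpoint (nest_max i T)) s.

End NestedLogit.

(* Main.v *)
(* Write z for the optimal revenue.  An assortment B is optimal iff it maximizes
   the sum over i of V_i(B_i)^g_i (R_i(B_i) - z), so it suffices that each term
   is maximized within the candidate set of nest i.  If B_i has
   d = R_i(B_i) - z > 0, every maximizer A of V_i(A) (R_i(A) - u) with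
   u = z + (1 - g_i) d satisfies
     R_i(A) - z >= d (g_i t + 1 - g_i) >= d t^g_i,   t = V_i(B_i) / V_i(A),
   by the tangent bound for the concave power, so A does at least as well.
   For the cardinality, a function that is constant off k points takes at most
   2k + 1 values.  A nest has at most (n + 1)^2 crosspoints, hence at most
   2 (n + 1)^2 + 1 <= 9 n^2 candidates; breakpoints of an upper envelope inject
   into its lines, so the nests have at most 9 m n^2 breakpoints altogether and
   there are at most 18 m n^2 + 1 <= 19 m n^2 assortments S(z). *)
Require Import Defs.
From mathcomp Require Import all_boot all_order all_algebra.
From mathcomp Require Import all_classical all_reals all_analysis.
From mathcomp Require Import zify ring lra.

Import Order.TTheory GRing.Theory Num.Theory.
Import numFieldNormedType.Exports.

Set Implicit Arguments.
Unset Strict Implicit.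

Local Open Scope classical_set_scope.
Local Open Scope ring_scope.

(** * Cardinality bounds through covering lists *)

Definition covered (T : eqType) (A : set T) (k : nat) :=
  exists2 s : seq T, (size s <= k)%N & A `<=` [set` s].

Lemma covered_card_le (T : eqType) (A : set T) k :
  covered A k -> (A #<= `I_k)%card.
Proof.
have [->|/set0P[x0 _] [s sk As]] := eqVneq A set0; first by rewrite card_ge0.
apply: (card_le_trans _ (card_image_le (nth x0 s) `I_k)).
apply: subset_card_le => x /As /= xs.
exists (index x s); last by rewrite nth_index.
by rewrite /= (leq_trans _ sk) // index_mem.
Qed.

Lemma covered_leq (T : eqType) (A : set T) k l :
  (k <= l)%N -> covered A k -> covered A l.
Proof. by move=> kl [s sk As]; exists s => //; apply: leq_trans kl. Qed.

Lemma covered_bigcup (I : finType) (T : eqType) (A : I -> set T) k :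
  (forall i, covered (A i) k) -> covered (\bigcup_i A i) (#|I| * k).
Proof.
move=> Ak; have {}Ak i : exists s : seq T, (size s <= k)%N /\ A i `<=` [set` s].
  by have [s] := Ak i; exists s.
case: (choice Ak) => s sP; exists (flatten [seq s i | i <- enum I]).
  rewrite size_flatten /shape -map_comp sumnE big_map big_enum /=.
  rewrite -sum_nat_const; apply: leq_sum => i _; by case: (sP i).
move=> x [i _ Aix] /=; apply/flatten_mapP; exists i; first by rewrite mem_enum.
by case: (sP i) => _; apply.
Qed.

(** Taking a relation [P] in place of a function avoids choosing one [y] for each [x]. *)
Lemma covered_inj (T : pointedType) (U : eqType) (A : set T) (B : set U)
    (P : T -> U -> Prop) k :
  (forall x, A x -> exists2 y, B y & P x y) ->
  (forall x x' y, A x -> A x' -> P x y -> P x' y -> x = x') ->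
  covered B k -> covered A k.
Proof.
move=> AB inj [s sk Bs].
exists [seq xget point [set x | A x /\ P x y] | y <- s].
  by rewrite size_map.
move=> x Ax /=; have [y By Pxy] := AB x Ax.
apply/mapP; exists y; first exact: Bs.
have [Ax' Px'] : [set x | A x /\ P x y] (xget point [set x | A x /\ P x y]).
  by apply: xgetPex; exists x.
exact: inj Ax Ax' Pxy Px'.
Qed.

(** At most [k] points leave at most [k + 1] open gaps, and [f] is constant on each gap; [code]
    tells these pieces apart. *)
Lemma covered_range (R : realType) (T : eqType) (D : set R) (f : R -> T) k :
  (forall x y, x <= y -> (forall t, x <= t <= y -> ~ D t) -> f x = f y) ->
  covered D k -> covered (range f) (2 * k + 1).
Proof.
move=> fD [s sk Ds].
(* [code x] separates two reals as soon as [s] meets the closed interval between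
   them; counting both [t < x] and [t <= x] lets it single out points of [s]. *)
pose code x := (count (< x) s + count (<= x) s)%N.
have count_lt x y : x <= y -> (count (< x) s <= count (< y) s)%N.
  by move=> xy; apply: sub_count => t /= /lt_le_trans; apply.
have count_le x y : x <= y -> (count (<= x) s <= count (<= y) s)%N.
  by move=> xy; apply: sub_count => t /= /le_trans; apply.
have count_ltn (p q : pred R) t : subpred p q -> t \in s -> ~~ p t -> q t ->
    (count p s < count q s)%N.
  move=> pq ts npt qt; apply: (@leq_trans (count (predU p (pred1 t)) s)).
    have := count_predUI p (pred1 t) s.
    rewrite (@eq_count _ (predI p _) pred0) ?count_pred0 => [|u /=].
      by rewrite addn0 => ->; rewrite -addn1 leq_add2l -has_count has_pred1.
    by apply/negP => /andP[pu /eqP ut]; rewrite ut (negPf npt) in pu.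
  by apply: sub_count => u /orP[/pq|/eqP->].
have codeE x y : x <= y -> code x = code y -> f x = f y.
  rewrite le_eqVlt => /predU1P[->//|xy] cxy; apply: fD; first exact: ltW.
  move=> t /andP[xt ty] /Ds /= ts.
  have := count_lt _ _ (ltW xy); have := count_le _ _ (ltW xy).
  move: cxy; rewrite /code.
  (* The point [t] raises the count of [<=] if [t = y], and the count of [<] if [t < y]. *)
  move: ty; rewrite le_eqVlt => /predU1P[ty|ty].
    have : (count (<= x) s < count (<= y) s)%N; last by lia.
    apply: (count_ltn _ _ t) => //=; last by rewrite ty.
      by move=> u /= /le_trans; apply; apply: ltW.
    by rewrite ty -ltNge.
  have : (count (< x) s < count (< y) s)%N; last by lia.
  apply: (count_ltn _ _ t) => //=; last by rewrite -leNgt.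
  by move=> u /= /lt_trans; apply.
exists [seq f (xget 0 [set x | code x = c]) | c <- iota 0 (2 * k + 1)].
  by rewrite size_map size_iota.
move=> _ [x _ <-] /=; apply/mapP; exists (code x).
  rewrite mem_iota add0n addn1 ltnS mul2n -addnn.
  by apply: leq_add; apply: leq_trans (count_size _ _) sk.
have cE : [set y | code y = code x] (xget 0 [set y | code y = code x]).
  by apply: xgetPex; exists x.
have /orP[xy|yx] := le_total x (xget 0 [set y | code y = code x]).
  by apply: codeE.
by apply/esym/codeE.
Qed.

(** * Breakpoints of the upper envelope of finitely many lines *)

Section UpperEnvelope.
Context {R : realType} {X : finType}.
Variables (T : set X) (a b : X -> R) (g : R -> R).
Hypothesis g_ub : forall A z, T A -> a A * z + b A <= g z.
Hypothesis g_attained : forall z, exists2 A, T A & g z = a A * z + b A.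

(** The line of largest slope among those active at [z] is the one that the envelope follows to the
    right of [z]; it serves as the label of a breakpoint. *)
Lemma steepest_active z :
  exists2 A, T A & g z = a A * z + b A /\
    forall B, T B -> g z = a B * z + b B -> a B <= a A.
Proof.
have [A0 TA0 gA0] := g_attained z.
pose P A := `[< T A /\ g z = a A * z + b A >].
have PA0 : P A0 by apply/asboolP.
case: (@arg_maxP _ R X A0 P a PA0) => A /asboolP[TA gA] Amax.
exists A => //; split=> // B TB gB; apply: Amax; exact/asboolP.
Qed.

(* If A is active at [d] and at [d' > d], it is active in between, so no active
   line at [d'] is less steep than A, since it would exceed A left of [d'].
   When A is also the steepest one, A is the only active line at [d']. *)
Lemma breakpoint_steepest_lt d d' A :
    d < d' -> T A -> g d = a A * d + b A -> g d' = a A * d' + b A ->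
    (forall B, T B -> g d' = a B * d' + b B -> a B <= a A) ->
  ~ breakpoint g d'.
Proof.
move=> dd' TA gd gd' steep; apply; exists (a A), (b A).
(* There are finitely many lines, so each may have its own neighbourhood of [d']. *)
suff le_A B : \forall y \near d', T B -> a B * y + b B <= a A * y + b A.
  have := @filter_forall _ _ _ _ (nbhs_filter d') le_A.
  apply: filterS => y AP; have [B TB gB] := g_attained y.
  by apply/eqP; rewrite eq_le g_ub // gB AP.
have [TB|nTB] := pselect (T B); last by apply: (@nearW _ (nbhs d')) => y /nTB.
have := g_ub d' TB; rewrite le_eqVlt => /predU1P[gB|gB].
  have aBA := steep B TB (esym gB).
  apply: (@nearW _ (nbhs d')) => y _.
  suff aE : a B = a A by move: gB; rewrite gd' aE => /addrI ->.
  apply/eqP; rewrite eq_le aBA /= leNgt; apply/negP => aBltA.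
  have gdB := g_ub d TB; rewrite gd in gdB; rewrite gd' in gB.
  have : 0 < (a A - a B) * (d' - d) by rewrite mulr_gt0 // subr_gt0.
  lra.
(* A line strictly below the envelope at [d'] stays below [A] nearby, by continuity. *)
have : (a A * y + b A) - (a B * y + b B) @[y --> d'] -->
    (a A * d' + b A) - (a B * d' + b B).
  have lin c e : c * y + e @[y --> d'] --> c * d' + e.
    apply: cvgD; last exact: cvg_cst.
    apply: cvgM; first exact: cvg_cst.
    exact: cvg_id.
  exact: cvgB.
move=> /cvgr_gt /(_ 0); rewrite subr_gt0 -gd' => /(_ gB).
by apply: filterS => y; rewrite subr_gt0 => /ltW.
Qed.

Lemma covered_breakpoint k : covered T k -> covered (breakpoint g) k.
Proof.
apply: (covered_inj (P := fun z A => T A /\ g z = a A * z + b A /\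
    forall B, T B -> g z = a B * z + b B -> a B <= a A)) => [z _|].
  by have [A TA H] := steepest_active z; exists A.
move=> d d' A bd bd' [TA [gd sd]] [_ [gd' sd']].
case: (ltgtP d d') => // dd'; exfalso.
  exact: (@breakpoint_steepest_lt d d' A) bd'.
exact: (@breakpoint_steepest_lt d' d A) bd.
Qed.

End UpperEnvelope.

(** The tangent of [ln] at [s] bounds [ln t] and [ln 1]; with weights [p] and [1 - p] the linear
    terms cancel, leaving [p * ln t <= ln s]. *)
Lemma powR_le_tangent (R : realType) (t p : R) :
  0 < t -> 0 <= p <= 1 -> t `^ p <= p * t + (1 - p).
Proof.
move=> t0 /andP[p0 p1]; set s := _ + _.
have s0 : 0 < s by rewrite /s; case: (ltrP p 1) => p1'; nra.
rewrite /powR gt_eqF // -[leRHS]lnK // ler_expR.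
have ln_le x : 0 < x -> ln x <= ln s + (x / s - 1).
  move=> x0; rewrite -lerBlDl -ln_div ?posrE //.
  have := @le_ln1Dx R (x / s - 1); rewrite [1 + _]addrC subrK; apply.
  by have := divr_gt0 x0 s0; lra.
have := ln_le _ t0; have := ln_le _ ltr01; rewrite ln1 => h1 ht.
have hs : p * (t / s - 1) + (1 - p) * (1 / s - 1) = 0.
  by rewrite /s; field; rewrite gt_eqF.
nra.
Qed.

(** * Candidates, breakpoints and optimality in the nested logit model *)

Section NestedLogitTheory.
Context {R : realType} {m n : nat}.
Variable I : nl_instance R m n.

Lemma line_affine i a u :
  line I i a u = line I i a 0 - (line I i a 0 - line I i a 1) * u.
Proof. case: a => [j|] /=; ring. Qed.

Lemma covered_crosspoint i : covered (crosspoint I i) ((n + 1) ^ 2).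
Proof.
(* Intercepts and slopes are read off the values at 0 and 1. Pairs of equal slope only add spurious
   entries, from division by 0. *)
pose L := line I i.
exists [seq (L a 0 - L b 0) / ((L a 0 - L a 1) - (L b 0 - L b 1))
  | a <- enum {: option 'I_n}, b <- enum {: option 'I_n}].
  by rewrite size_allpairs -cardE card_option card_ord addn1 mulnn.
move=> u [a [b [ab abu]]] /=; apply/allpairsP; exists (a, b) => /=.
rewrite !mem_enum; split=> //.
move: abu; rewrite (line_affine i a u) (line_affine i b u) -/L => abu.
suff h : (L a 0 - L a 1) - (L b 0 - L b 1) != 0.
  by apply: (mulIf h); rewrite mulfVK //; lra.
apply/eqP => h; apply: ab; apply/funext => v.
rewrite (line_affine i a v) (line_affine i b v) -/L; move: abu.
rewrite (_ : L a 0 - L a 1 = L b 0 - L b 1); lra.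
Qed.

Lemma nestV_ge0 i A : 0 <= nestV I i A.
Proof. by apply: sumr_ge0 => j _; apply: weight_ge0. Qed.

Lemma linear_optimal_nest_objective i (hatS : R -> {set 'I_n}) z
    (B : {set 'I_n}) :
    (forall u, linear_optimal I i u (hatS u)) -> (#|B| <= capacity I i)%N ->
  exists u, nest_objective I i z B <= nest_objective I i z (hatS u).
Proof.
move=> hatP Bcap; rewrite /nest_objective.
have g0 := dissim_gt0 I i; have g1 := dissim_le1 I i.
set g := dissim I i in g0 g1 *.
have := nestV_ge0 i B; rewrite le_eqVlt => VB.
have [dB|dB] := lerP (nestV I i B `^ g * (nestR I i B - z)) 0.
  (* Comparison with the empty set shows that the maximizer at [u = z] has a nonnegative
     objective. *)
  exists z; apply: (le_trans dB).
  have [_ /(_ finset.set0)] := hatP z; rewrite cards0 => /(_ isT).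
  rewrite {1}/nestV big_set0 mul0r.
  have := nestV_ge0 i (hatS z); rewrite le_eqVlt => /predU1P[<- _|V0].
    by rewrite powR0 ?mul0r // gt_eqF.
  by rewrite !pmulr_rge0 // powR_gt0.
have VB0 : 0 < nestV I i B.
  case/predU1P: VB => // VB; move: dB; rewrite -VB powR0 ?mul0r ?ltxx //.
  by rewrite gt_eqF.
have d0 : 0 < nestR I i B - z by move: dB; rewrite pmulr_rgt0 // powR_gt0.
set d := nestR I i B - z in d0 *.
exists (z + (1 - g) * d); have [_ /(_ B Bcap)] := hatP (z + (1 - g) * d).
set A := hatS _.
have -> : nestR I i B - (z + (1 - g) * d) = g * d by rewrite /d; ring.
move=> hA.
(* The value of [B] at this [u] is positive, so its maximizer [A] cannot have weight 0. *)
have VA0 : 0 < nestV I i A.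
  rewrite lt_neqAle nestV_ge0 andbT; apply/eqP => VA.
  move: hA; rewrite -VA mul0r leNgt; have := mulr_gt0 VB0 (mulr_gt0 g0 d0).
  by move=> ->.
set t := nestV I i B / nestV I i A.
have t0 : 0 < t by rewrite divr_gt0.
have Bt : nestV I i B = nestV I i A * t by rewrite mulrC mulfVK // gt_eqF.
rewrite Bt (powRM _ (ltW VA0) (ltW t0)) -mulrA ler_pM2l ?powR_gt0 //.
have := @powR_le_tangent R t g t0; rewrite (ltW g0) g1 => /(_ isT) tg.
apply: (@le_trans _ _ ((g * t + (1 - g)) * d)); first by rewrite ler_pM2r.
move: hA; rewrite Bt -mulrA ler_pM2l // => hA; lra.
Qed.

Lemma nest_objective_affine i z A :
  nest_objective I i z A = - nestV I i A `^ dissim I i * z +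
    nestV I i A `^ dissim I i * nestR I i A.
Proof. by rewrite /nest_objective; ring. Qed.

Lemma nest_max_eq i (T : set {set 'I_n}) z A : T A ->
  (forall B, T B -> nest_objective I i z B <= nest_objective I i z A) ->
  nest_max I i T z = nest_objective I i z A.
Proof.
move=> TA Amax; apply/eqP; rewrite eq_le; apply/andP; split.
  apply: ge_sup; first by exists (nest_objective I i z A), A.
  by move=> _ [B TB <-]; apply: Amax.
apply: ub_le_sup; last by exists A.
by exists (nest_objective I i z A) => _ [B TB <-]; apply: Amax.
Qed.

(** The selection [s] attains the supremum at every [z], so [nest_max] is an upper envelope of lines
    indexed by [T]. *)
Lemma covered_nest_max_breakpoint i (T : set {set 'I_n}) s k :
  revenue_selection I i T s -> covered T k ->
  covered (breakpoint (nest_max I i T)) k.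
Proof.
move=> [sP _].
have gE z : nest_max I i T z = nest_objective I i z (s z).
  by have [? ?] := sP z; apply: nest_max_eq.
apply: (covered_breakpoint (a := fun A => - nestV I i A `^ dissim I i)
    (b := fun A => nestV I i A `^ dissim I i * nestR I i A)).
  by move=> A z TA; rewrite gE -nest_objective_affine; apply: (sP z).2.
by move=> z; exists (s z); [exact: (sP z).1 | rewrite gE nest_objective_affine].
Qed.

Lemma denominator_gt0 (A : assortment m n) :
  0 < nopurchase I + \sum_i nestV I i (A i) `^ dissim I i.
Proof.
by rewrite ltr_pwDl ?nopurchase_gt0 // sumr_ge0 // => i _; apply: powR_ge0.
Qed.

(** Clearing the positive denominator turns the ratio into a sum that can be compared nest by
    nest. *)
Lemma expected_revenue_ge z (A : assortment m n) :
  (z <= expected_revenue I A) =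
  (nopurchase I * z <= \sum_i nest_objective I i z (A i)).
Proof.
rewrite /expected_revenue ler_pdivlMr ?denominator_gt0 //.
under [in RHS]eq_bigr do rewrite /nest_objective mulrBr.
rewrite sumrB -mulr_suml lerBrDr mulrDr [z * nopurchase I]mulrC.
by rewrite [z * \sum_i _]mulrC.
Qed.

Lemma optimal_exists : exists A, optimal I A.
Proof.
pose P (A : assortment m n) := [forall i, #|A i| <= capacity I i]%N.
have P0 : P [ffun=> finset.set0] by apply/forallP => i; rewrite ffunE cards0.
case: (@arg_maxP _ R _ _ P (expected_revenue I) P0) => A /forallP PA Amax.
by exists A; split=> // B FB; apply: Amax; apply/forallP.
Qed.

End NestedLogitTheory.

Theorem proposition4 :
  exists K : nat,
  forall (R : realType) (m n : nat) (I : nl_instance R m n)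
    (hatS : 'I_m -> R -> {set 'I_n}) (S : R -> assortment m n),
    (1 <= m)%N -> (1 <= n)%N ->
    (forall i, candidate_selection I i (hatS i)) ->
    (forall i, revenue_selection I i (range (hatS i)) (fun z => S z i)) ->
    (exists2 A, range S A & optimal I A) /\
    (range S #<= `I_(K * m * n ^ 2))%card.
Proof.
exists 19%N => R m n I hatS S m1 n1 hatP SP; split.
  have [B [Bfeas Bopt]] := optimal_exists I.
  pose z := expected_revenue I B.
  exists (S z); first by exists z.
  have Sz : z <= expected_revenue I (S z).
    (* This reflexive bound, once cleared of its denominator, carries over from [B] to [S z]
       termwise. *)
    have : z <= expected_revenue I B by [].
    rewrite !expected_revenue_ge => /le_trans; apply; apply: ler_sum => i _.
    have [u hu] := linear_optimal_nest_objective z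
      (fun u => ((hatP i).1 u).1) (Bfeas i).
    by apply: (le_trans hu); apply: ((SP i).1 z).2; exists u.
  split=> [i|A /Bopt /le_trans]; last exact.
  have [[u _ <-] _] := (SP i).1 z; exact: ((hatP i).1 u).1.1.
have cover_hatS i : covered (range (hatS i)) (9 * n ^ 2).
  have := covered_range (hatP i).2.1 (covered_crosspoint I i).
  apply: covered_leq; nia.
pose D i := breakpoint (nest_max I i (range (hatS i))).
have cover_D : covered (\bigcup_i D i) (#|'I_m| * (9 * n ^ 2)).
  by apply: covered_bigcup => i; apply: covered_nest_max_breakpoint (SP i) _.
have cS := covered_range (f := S) _ cover_D.
rewrite card_ord in cS; apply: covered_card_le.
apply: covered_leq (cS _); first by nia.
move=> x y xy nD; apply/ffunP => i; apply: (SP i).2.1 => // t xty Dt.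
by apply: (nD t xty); exists i.
Qed.
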